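(* Let $M\subseteq\mathbb{F}_2^n$ be a set such that $M$ contains a basis of $\mathbb{F}_2^n$, the zero vector belongs to $M$, and $|M|<2^n$. Let $k$ be a positive integer with $k+1\le |M|\le 2^{n/k}$. Then there exists a subset $K\subseteq M$ of $k+1$ vectors such that no sum of two or more distinct vectors of $K$ lies in $M$; moreover, such a set $K$ can be found in time $|M|^{O(1)}$. *)

(* Defs.v *)
From Stdlib Require Import Reals.
From HB Require Import structures.
From mathcomp Require Import all_boot all_order all_algebra.

Set Implicit Arguments.
Unset Strict Implicit.
Unset Printing Implicit Defensive.

Definition contains_basis (n : nat) (M : {set 'rV['F_2]_n}) : Prop :=
  exists b : seq 'rV['F_2]_n,
    {subset b <= M} /\ basis_of (fullv : {vspace 'rV['F_2]_n}) b.

Definition admissible (n : nat) (M : {set 'rV['F_2]_n}) (k : nat) : Prop :=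
  [/\ contains_basis M, (0%R : 'rV['F_2]_n) \in M & #|M| < 2 ^ n] /\
  [/\ 0 < k, k + 1 <= #|M|
    & Rle (INR #|M|) (Rpower (INR 2) (Rdiv (INR n) (INR k)))].

Definition sums_avoid (n : nat) (M K : {set 'rV['F_2]_n}) : Prop :=
  forall S : {set 'rV['F_2]_n},
    S \subset K -> 2 <= #|S| -> (\sum_(x in S) x)%R \notin M.

Definition solution (n : nat) (M : {set 'rV['F_2]_n}) (k : nat)
    (K : {set 'rV['F_2]_n}) : Prop :=
  [/\ K \subset M, #|K| = k + 1 & sums_avoid M K].

(* Model of computation: the first-order functional language F on binary trees
   of N. D. Jones, Computability and Complexity from a Programming Perspective,
   with finitely many mutually recursive functions instead of one.  Every
   function has a single argument, and a program is the list of the function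
   bodies; function 0 is the entry point.  The running time of a call-by-value
   evaluation is the number of expression nodes evaluated.  A node only copies
   a pointer, allocates or inspects one cell, or makes a call, so that running
   times agree with those of Turing machines up to a polynomial. *)

Inductive tree : Type := Leaf | Node of tree & tree.

Definition hd (d : tree) : tree := if d is Node a _ then a else Leaf.
Definition tl (d : tree) : tree := if d is Node _ b then b else Leaf.

Inductive exp : Type :=
  | Arg
  | Nil
  | Cons of exp & exp
  | Hd of exp
  | Tl of exp
  | If of exp & exp & exp
  | Call of nat & exp.

Definition program : Type := seq exp.

(* [eval P x e d t]: in program P, when the argument of the current function is
   x, the expression e evaluates to d in time t. *)
Inductive eval (P : program) : tree -> exp -> tree -> nat -> Prop :=
  | EArg x : eval P x Arg x 1
  | ENil x : eval P x Nil Leaf 1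
  | ECons x e1 e2 d1 d2 t1 t2 :
      eval P x e1 d1 t1 -> eval P x e2 d2 t2 ->
      eval P x (Cons e1 e2) (Node d1 d2) (t1 + t2).+1
  | EHd x e d t : eval P x e d t -> eval P x (Hd e) (hd d) t.+1
  | ETl x e d t : eval P x e d t -> eval P x (Tl e) (tl d) t.+1
  | EIfNode x e e1 e2 a b d t t1 :
      eval P x e (Node a b) t -> eval P x e1 d t1 ->
      eval P x (If e e1 e2) d (t + t1).+1
  | EIfLeaf x e e1 e2 d t t2 :
      eval P x e Leaf t -> eval P x e2 d t2 ->
      eval P x (If e e1 e2) d (t + t2).+1
  | ECall x f e y d t t' :
      f < size P -> eval P x e y t -> eval P y (nth Nil P f) d t' ->
      eval P x (Call f e) d (t + t').+1.

Definition run (P : program) (input output : tree) (time : nat) : Prop :=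
  eval P input (Call 0 Arg) output time.

Lemma eval_det (P : program) x e d1 t1 d2 t2 :
  eval P x e d1 t1 -> eval P x e d2 t2 -> d1 = d2 /\ t1 = t2.
Proof.
move=> H; elim: H d2 t2 => {x e d1 t1}; intros;
  match goal with H : eval _ _ _ ?d ?t |- _ = ?d /\ _ = ?t =>
    inversion H; subst end => //;
  repeat match goal with
  | IH : forall d t, eval P ?x ?e d t -> _, H : eval P ?x ?e ?d ?t |- _ =>
      let E := fresh "E" in
      case: (IH d t H) => E ?; clear IH; try discriminate E; subst
  end => //.
Qed.

Definition enc_seq (T : Type) (enc : T -> tree) (s : seq T) : tree :=
  foldr (fun x d => Node (enc x) d) Leaf s.

Definition enc_bit (b : 'F_2) : tree :=
  if b == 0%R then Leaf else Node Leaf Leaf.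

Definition enc_vec (n : nat) (v : 'rV['F_2]_n) : tree :=
  enc_seq enc_bit [seq v ord0 i | i <- enum 'I_n].

Definition enc_vecs (n : nat) (s : seq 'rV['F_2]_n) : tree :=
  enc_seq (@enc_vec n) s.

(* Unary; the inputs satisfy k < #|M|, so this does not enlarge the time bound
   beyond a polynomial in #|M|. *)
Definition enc_nat (k : nat) : tree := enc_seq id (nseq k Leaf).

Definition lists (n : nat) (s : seq 'rV['F_2]_n) (M : {set 'rV['F_2]_n}) :
    Prop :=
  uniq s /\ s =i M.

(* Main.v *)
(** Identify vectors of M modulo a subspace U and let L be a greedily chosen
    list of elements of M whose class modulo U + <L> is nonzero and contains a
    single class modulo U.  No sum of two or more elements of L then lies in
    M + U, so a list of length k + 1 is a solution.  If the greedy choice stops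
    earlier, every class modulo U + <L> contains at least two classes modulo U:
    enlarging U to U + <L> halves the number N of classes while the dimension r
    of the quotient drops by at most k, so N^k <= 2^r persists and the process
    restarts.  It cannot end with r <= k, because N > r as the images of M span
    and include 0.  The quotient map is represented by Gaussian elimination. *)

Require Import Defs.
From Stdlib Require Import Reals.
From HB Require Import structures.
From mathcomp Require Import all_boot all_order all_algebra zify.

Set Implicit Arguments.
Unset Strict Implicit.
Unset Printing Implicit Defensive.

Import GRing.Theory.

(** * Integer form of the size bound, and deduplication of lists *)

Lemma F2_neq0 (x : 'F_2) : x != 0%R -> x = 1%R.
Proof. by case: x => [[|[|x]]] //= lt_x _; apply/val_inj. Qed.

Lemma leq_INR (m n : nat) : Rle (INR m) (INR n) -> m <= n.
Proof. by move/INR_le/leP. Qed.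

Lemma INR_expn (m n : nat) : INR (m ^ n) = pow (INR m) n.
Proof. by elim: n => //= n IHn; rewrite expnS -IHn -mult_INR multE. Qed.

(** Raising both sides to the power [k] clears the real exponent; the rest of the argument is about
    integers. *)
Lemma expn_le_of_Rpower (N n k : nat) :
  0 < k -> Rle (INR N) (Rpower (INR 2) (Rdiv (INR n) (INR k))) ->
  N ^ k <= 2 ^ n.
Proof.
move=> k_gt0 leN; apply: leq_INR; rewrite !INR_expn.
have kR : INR k <> R0 by apply: not_0_INR; lia.
have gt0_2 : Rlt R0 (INR 2) by apply: lt_0_INR; lia.
have -> : pow (INR 2) n = pow (Rpower (INR 2) (Rdiv (INR n) (INR k))) k.
  rewrite -(Rpower_pow k); last exact: exp_pos.
  rewrite Rpower_mult /Rdiv Rmult_assoc Rinv_l // Rmult_1_r Rpower_pow //.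
by apply: pow_incr; split=> //; apply: pos_INR.
Qed.

(** The size of [s] is the sum of the multiplicities of its distinct values. This is the source of
    the halving of the number of classes. *)
Lemma size_undup_double (T : eqType) (s : seq T) :
  {in s, forall x, 2 <= count_mem x s} -> 2 * size (undup s) <= size s.
Proof.
move=> ge2; rewrite -(perm_size (perm_count_undup s)) size_flatten sumnE.
rewrite !big_map mulnC -sum1_size big_distrl /= !big_seq.
apply: leq_sum => x; rewrite mem_undup size_nseq => /ge2.
by rewrite mul1n.
Qed.

(** With pairs (class, representative), one representative per class survives: the last one, so that
    the keys agree with [undup]. *)
Fixpoint undup_fst (T U : eqType) (l : seq (T * U)) : seq (T * U) :=
  if l is e :: l' then
    if e.1 \in unzip1 l' then undup_fst l' else e :: undup_fst l'
  else [::].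

Lemma unzip1_undup_fst (T U : eqType) (l : seq (T * U)) :
  unzip1 (undup_fst l) = undup (unzip1 l).
Proof. by elim: l => //= e l <-; case: ifP. Qed.

Lemma mem_undup_fst (T U : eqType) (l : seq (T * U)) :
  {subset undup_fst l <= l}.
Proof.
elim: l => //= e l IHl x; case: ifP => _; rewrite !inE.
  by move/IHl->; rewrite orbT.
by case/orP=> [-> //|/IHl ->]; rewrite orbT.
Qed.

(** * Gaussian elimination by a single vector *)

Section Greedy.

Variable n : nat.
Notation V := 'rV['F_2]_n.

Definition bits (v : V) : seq 'F_2 := [seq v ord0 i | i <- enum 'I_n].

(** For [a = 0] the value is [n], out of range; the default 0 in [pivot_coord] then makes [reduce a]
    the identity. *)
Definition pivot (a : V) : nat := find (fun b => b != 0%R) (bits a).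

Definition pivot_coord (a v : V) : 'F_2 := nth 0%R (bits v) (pivot a).

(** For [a != 0] this is the linear projection with kernel [<[a]>] that clears the pivot coordinate
    of [a]. Classes modulo [a] thus have normal forms, compared by plain equality. *)
Definition reduce (a v : V) : V :=
  if pivot_coord a v != 0%R then (a + v)%R else v.

Lemma size_bits (v : V) : size (bits v) = n.
Proof. by rewrite size_map size_enum_ord. Qed.

Lemma nth_bits (v : V) (i : 'I_n) : nth 0%R (bits v) i = v ord0 i.
Proof. by rewrite (nth_map i) ?size_enum_ord // nth_ord_enum. Qed.

Lemma pivot_coordD (a u v : V) :
  pivot_coord a (u + v)%R = (pivot_coord a u + pivot_coord a v)%R.
Proof.
rewrite /pivot_coord; case: (ltnP (pivot a) n) => [lt_an | le_na].
  by rewrite !(nth_bits _ (Ordinal lt_an)) mxE.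
by rewrite !nth_default ?size_bits ?addr0.
Qed.

Lemma pivot_coord_id (a : V) : a != 0%R -> pivot_coord a a != 0%R.
Proof.
move=> a_neq0; rewrite /pivot_coord; apply: (@nth_find _ 0%R (fun b => b != 0%R)).
rewrite has_map.
apply/negPn/negP => /hasPn /= a0; case/eqP: a_neq0.
apply/rowP => i; rewrite mxE; apply/eqP.
by have := a0 i; rewrite mem_enum negbK; apply.
Qed.

Lemma reduceE (a v : V) : reduce a v = (v + pivot_coord a v *: a)%R.
Proof.
rewrite /reduce; case: eqP => [->|/eqP/F2_neq0 ->]; first by rewrite scale0r addr0.
by rewrite scale1r addrC.
Qed.

Lemma reduceD (a : V) : {morph reduce a : u v / (u + v)%R}.
Proof.
by move=> u v; rewrite !reduceE pivot_coordD scalerDl addrACA.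
Qed.

Lemma addvv (v : V) : (v + v)%R = 0%R.
Proof.
apply/rowP => i; rewrite !mxE.
by case: (eqVneq (v ord0 i) 0%R) => [->|/F2_neq0 ->]; [rewrite addr0 | apply/val_inj].
Qed.

Lemma reduce_id (a : V) : a != 0%R -> reduce a a = 0%R.
Proof. by move=> a0; rewrite /reduce pivot_coord_id // addvv. Qed.

(** Each [v] differs from [reduce a v] by a multiple of [a], so adding the line of [a] to the span
    of the images recovers the original span. *)
Lemma dim_reduce (a : V) (s : seq V) :
  \dim <<s>> <= (\dim <<map (reduce a) s>>).+1.
Proof.
have /dimvS le_s : (<<s>> <= <<map (reduce a) s>> + <[a]>)%VS.
  apply/span_subvP => v sv.
  have -> : v = (reduce a v - pivot_coord a v *: a)%R by rewrite reduceE addrK.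
  apply: memv_add; first exact/memv_span/map_f.
  by rewrite memvN memvZ // memv_line.
apply: leq_trans le_s _; apply: leq_trans (dimv_add_leqif _ _).1 _.
by rewrite dim_vline; case: (a != 0%R); rewrite ?addn1 ?addn0.
Qed.

(** Removing one occurrence of 0 leaves the span unchanged. *)
Lemma dim_span_lt_size (s : seq V) : 0%R \in s -> \dim <<s>> < size s.
Proof.
move=> s0; have sz : (size (rem 0%R s)).+1 = size s.
  by rewrite size_rem // prednK //; case: (s) s0.
rewrite -sz ltnS; apply: leq_trans (dim_span _).
apply/dimvS/span_subvP => v; case: (eqVneq v 0%R) => [-> _|v0 sv].
  exact: mem0v.
apply: memv_span; have := perm_mem (perm_to_rem s0) v.
by rewrite sv inE (negPf v0).
Qed.

(** * The greedy invariant and its preservation *)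

Definition candidate (w : seq (V * V)) (e : V * V) : bool :=
  (e.1 != 0%R) && (count_mem e.1 (unzip1 w) <= 1).

(* [l] lists pairs (phi m, m), where phi is the quotient map at the current
   point and psi the one at the start of the current greedy round; [A] holds
   the vectors chosen in this round. *)
Record greedy_inv (M : {set V}) (k r : nat) (psi phi : V -> V)
    (l : seq (V * V)) (A : seq V) : Prop := GreedyInv {
  psiD : {morph psi : u v / (u + v)%R};
  phiD : {morph phi : u v / (u + v)%R};
  psi_phi : forall u v, psi u = psi v -> phi u = phi v;
  lE : {in l, forall e, e.1 = phi e.2};
  l_sub : {subset unzip2 l <= M};
  l_cover : {in M, forall m, exists2 e, e \in l & psi e.2 = psi m};
  l_uniq : uniq (map psi (unzip2 l));
  A_sub : {subset A <= unzip2 l};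
  A_uniq : uniq A;
  A_phi : {in A, forall a, phi a = 0%R};
  A_psi : {in A, forall a, psi a != 0%R};
  A_avoid : forall S : {set V}, {subset S <= A} -> 2 <= #|S| ->
    {in M, forall m, psi (\sum_(x in S) x)%R != psi m};
  A_nil : A = [::] -> uniq (unzip1 l);
  size_A : size A <= k;
  l_expn : size l ^ k <= 2 ^ r;
  l_lt : size l < 2 ^ r;
  r_gt : k < r;
  r_dim : r <= \dim <<unzip1 l>> + size A
}.

Lemma morph0 (f : V -> V) : {morph f : u v / (u + v)%R} -> f 0%R = 0%R.
Proof. by move=> fD; have := fD 0%R 0%R; rewrite !addvv. Qed.

Lemma unzip1_phi (phi : V -> V) (l : seq (V * V)) :
  {in l, forall e, e.1 = phi e.2} -> unzip1 l = map phi (unzip2 l).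
Proof. by move=> lE; rewrite -map_comp; apply/eq_in_map. Qed.

(** Suppose [a + y], with [y] a sum over [A], agrees under [psi] with a representative [t]. As [phi]
    kills [y], it identifies [t] with [a], so [t = a] and [psi y = 0]. *)
Lemma avoid_cons (M : {set V}) (psi phi : V -> V) (T A : seq V) (a : V) :
  {morph psi : u v / (u + v)%R} -> {morph phi : u v / (u + v)%R} ->
  (forall u v, psi u = psi v -> phi u = phi v) ->
  0%R \in M ->
  {in M, forall m, exists2 t, t \in T & psi t = psi m} ->
  {in A, forall x, phi x = 0%R} -> {in A, forall x, psi x != 0%R} ->
  {in T, forall t, phi t = phi a -> t = a} ->
  (forall S : {set V}, {subset S <= A} -> 2 <= #|S| ->
    {in M, forall m, psi (\sum_(x in S) x)%R != psi m}) ->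
  forall S : {set V}, {subset S <= a :: A} -> 2 <= #|S| ->
    {in M, forall m, psi (\sum_(x in S) x)%R != psi m}.
Proof.
move=> psiD phiD psi_phi M0 cover A_phi A_psi a_uniq avoid S sSA cS m mM.
have psi0 := morph0 psiD; have phi0 := morph0 phiD.
have [aS|aS] := boolP (a \in S); last first.
  apply: avoid => // x xS; have := sSA x xS; rewrite inE => /predU1P[xa|//].
  by rewrite -xa xS in aS.
have sS'A : {subset S :\ a <= A}.
  by move=> x; rewrite !inE => /andP[xa /sSA]; rewrite inE (negPf xa).
have cS' : 0 < #|S :\ a| by move: cS; rewrite (cardsD1 a) aS.
rewrite (big_setD1 a aS) /=; set y := (\sum_(x in _) _)%R.
have phiy : phi y = 0%R.
  rewrite /y (big_morph phi phiD phi0) big1 // => x /sS'A; exact: A_phi.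
apply/eqP => Em; have [t tT Et] := cover m mM.
have ta : t = a.
  by apply: a_uniq => //; rewrite (psi_phi t _ (etrans Et (esym Em))) phiD phiy addr0.
have psiy : psi y = 0%R.
  by apply: (@addrI _ (psi a)); rewrite addr0 -psiD Em -Et ta.
(* A single remaining vector has nonzero image under [psi]; two or more would have a sum equal under
   [psi] to [0], which lies in [M]. *)
have [c1|c2] := leqP #|S :\ a| 1.
  have /cards1P[x Sx] : #|S :\ a| == 1 by rewrite eqn_leq c1.
  have xA : x \in A by apply: sS'A; rewrite Sx inE.
  by move: psiy; rewrite /y Sx big_set1; apply/eqP/A_psi.
by have /eqP := avoid _ sS'A c2 _ M0; rewrite -/y psiy psi0.
Qed.

(** The power bound follows by cancelling [2 ^ k] from [(2 * N') ^ k <= N ^ k <= 2 ^ r]. *)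
Lemma expn_halve (N N' k r : nat) :
  0 < k -> k < r -> 2 * N' <= N -> N ^ k <= 2 ^ r -> N < 2 ^ r ->
  N' ^ k <= 2 ^ (r - k) /\ N' < 2 ^ (r - k).
Proof.
move=> k_gt0 lt_kr leN' leN ltN.
have E : 2 ^ r = 2 ^ k * 2 ^ (r - k) by rewrite -expnD subnKC // ltnW.
have leN'k : N' ^ k <= 2 ^ (r - k).
  rewrite -(leq_pmul2l (expn_gt0 2 k)) -E -expnMn.
  by apply: leq_trans leN; rewrite leq_exp2r.
split=> //; rewrite ltnNge; apply/negP => leN2.
(* For [k > 1] the power bound already forces strictness, since [r - k > 0]; for [k = 1] strictness
   comes from [N < 2 ^ r]. *)
case: (ltngtP k 1) => [|k_gt1|k1]; first by lia.
  have : 2 ^ ((r - k) * k) <= 2 ^ (r - k).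
    by rewrite expnM; apply: leq_trans leN'k; rewrite leq_exp2r.
  by rewrite leq_exp2l //; nia.
by move: E leN2; rewrite k1 expn1; lia.
Qed.

(** If [r <= k], then [N ^ k <= 2 ^ k] gives [N <= 2], so [r = 1], and [N < 2 ^ r] contradicts
    [r < N]. *)
Lemma round_dim (N k r : nat) :
  0 < k -> r < N -> N ^ k <= 2 ^ r -> N < 2 ^ r -> k < r.
Proof.
move=> k_gt0 ltrN leN ltN; rewrite ltnNge; apply/negP => le_rk.
have r_gt0 : 0 < r by case: r ltN ltrN {leN le_rk} => //=; rewrite expn0; case: N => // N; lia.
have N2 : N <= 2.
  rewrite -(leq_exp2r _ _ k_gt0); apply: leq_trans leN _.
  by rewrite leq_exp2l.
have r1 : r = 1 by lia.
by move: ltN; rewrite r1 expn1; lia.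
Qed.

(** Representatives in [l] are distinct, so a key occurring once is separated by [phi] from all
    other classes and [avoid_cons] applies. The first three conclusions also cover the final pick,
    where [A] already has [k] vectors. *)
Lemma greedy_pick (M : {set V}) (k r : nat) (psi phi : V -> V)
    (l : seq (V * V)) (A : seq V) (e : V * V) :
  0%R \in M -> greedy_inv M k r psi phi l A ->
  e \in l -> candidate l e ->
  [/\ {subset e.2 :: A <= unzip2 l}, uniq (e.2 :: A),
      forall S : {set V}, {subset S <= e.2 :: A} -> 2 <= #|S| ->
        {in M, forall m, psi (\sum_(x in S) x)%R != psi m}
    & size A < k ->
      greedy_inv M k r psi (reduce e.1 \o phi)
        [seq (reduce e.1 x.1, x.2) | x <- l] (e.2 :: A)].
Proof.
move=> M0 [psiD phiD pp lE lM cover luniq AT Auniq Aphi Apsi avoid Anil szA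
           lexp llt rgt rdim] el /andP[e0 ecnt].
have l1E := unzip1_phi lE.
have e2T : e.2 \in unzip2 l by exact: map_f.
have e_uniq : {in unzip2 l, forall t, phi t = phi e.2 -> t = e.2}.
  (* Another representative with the same key would bring the count of [e.1] to two. *)
  move=> t tT Et; apply/eqP; apply: contraTT ecnt => te; rewrite -ltnNge.
  have Tu : uniq (unzip2 l) by exact: map_uniq luniq.
  rewrite l1E count_map.
  have : count (mem [:: t; e.2]) (unzip2 l) <= count (preim phi (pred1 e.1)) (unzip2 l).
    apply: sub_count => x; rewrite !inE /= => /orP[]/eqP->; by rewrite ?Et lE.
  apply: leq_trans.
  rewrite -size_filter (@perm_size _ _ [:: t; e.2]) //.
  apply: uniq_perm; rewrite ?filter_uniq //= ?inE ?te //.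
  move=> x; rewrite mem_filter !inE.
  by apply: andb_idr => /orP[]/eqP->.
have av : forall S : {set V}, {subset S <= e.2 :: A} -> 2 <= #|S| ->
        {in M, forall m, psi (\sum_(x in S) x)%R != psi m}.
  apply: (@avoid_cons M psi phi (unzip2 l)) => // m /cover[x xl Ex].
  by exists x.2 => //; apply: map_f.
have eA : e.2 \notin A.
  by apply: contra e0 => /Aphi <-; rewrite lE.
have sub : {subset e.2 :: A <= unzip2 l}.
  by move=> x; rewrite inE => /predU1P[->|/AT].
have u2 : unzip2 [seq (reduce e.1 x.1, x.2) | x <- l] = unzip2 l.
  by rewrite /unzip2 -map_comp.
have u1 : unzip1 [seq (reduce e.1 x.1, x.2) | x <- l] = map (reduce e.1) (unzip1 l).
  by rewrite /unzip1 -!map_comp.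
have phie : phi e.2 = e.1 by rewrite lE.
split=> //=; first by rewrite eA.
move=> ltA; split=> //=.
- by move=> u v /=; rewrite phiD reduceD.
- by move=> u v /pp /= ->.
- by move=> _ /mapP[x xl ->] /=; rewrite (lE x).
- by rewrite u2.
- move=> m /cover[x xl Ex]; exists (reduce e.1 x.1, x.2) => //.
  by apply/mapP; exists x.
- by rewrite u2.
- by rewrite u2.
- by rewrite eA.
- move=> x; rewrite inE => /predU1P[->|/Aphi ->].
    by rewrite phie reduce_id.
  exact/morph0/reduceD.
- move=> x; rewrite inE => /predU1P[->|/Apsi //].
  apply: contra e0 => /eqP Ee; rewrite -phie.
  by rewrite (pp _ 0%R) ?morph0.
- by rewrite size_map.
- by rewrite size_map.
(* The dimension lost to the reduction is repaid by the extra vector in [A]. *)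
- rewrite u1 addnS -addSn; apply: leq_trans rdim _.
  by rewrite leq_add2r dim_reduce.
Qed.

(** Without a candidate every key is repeated, so deduplication halves the list and [phi] takes over
    as [psi]. Charging [k] dimensions to the round is safe because [size A <= k]. *)
Lemma greedy_stuck (M : {set V}) (k r : nat) (psi phi : V -> V)
    (l : seq (V * V)) (A : seq V) :
  0 < k -> 0%R \in M -> greedy_inv M k r psi phi l A ->
  ~~ has (candidate l) l ->
  size (undup_fst l) < size l /\
  greedy_inv M k (r - k) phi phi (undup_fst l) [::].
Proof.
move=> k_gt0 M0 [psiD phiD pp lE lM cover luniq AT Auniq Aphi Apsi avoid Anil szA
           lexp llt rgt rdim] /hasPn stuck.
have l1E := unzip1_phi lE.
have [e0 e0l e0psi] := cover _ M0.
have e0_0 : e0.1 = 0%R by rewrite lE // (pp _ _ e0psi) morph0.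
have cnt : {in unzip1 l, forall x, x != 0%R -> 2 <= count_mem x (unzip1 l)}.
  move=> _ /mapP[x xl ->] x0; have := stuck x xl.
  by rewrite /candidate x0 /= -ltnNge.
(* In a fresh round the keys are distinct, so a stuck list would have only the key 0 and span
   dimension 0, against [0 < k < r]. *)
have A_neq0 : A != [::].
  apply/eqP => A0; have u := Anil A0; move: rdim; rewrite A0 addn0.
  have : (<<unzip1 l>> <= 0)%VS.
    apply/span_subvP => x xl; rewrite memv0; apply/negPn/negP => x0.
    by have := cnt x xl x0; rewrite count_uniq_mem // xl.
  by rewrite subv0 => /eqP ->; rewrite dimv0; lia.
(* The key 0 is repeated too: any vector of [A] and the representative of the class of [0] share it,
   and [psi] tells them apart. *)
have cnt2 : {in unzip1 l, forall x, 2 <= count_mem x (unzip1 l)}.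
  move=> x xl; case: (eqVneq x 0%R) => [->|]; last exact: cnt.
  case: A A_neq0 AT {Auniq avoid Anil szA rdim} Aphi Apsi => // a A _ AT Aphi Apsi.
  have aT : a \in unzip2 l by apply: AT; rewrite mem_head.
  have eT : e0.2 \in unzip2 l by exact: map_f.
  have ae : a != e0.2.
    apply: contra (Apsi a (mem_head _ _)) => /eqP->; by rewrite e0psi morph0.
  have Tu : uniq (unzip2 l) by exact: map_uniq luniq.
  rewrite l1E count_map.
  apply: (@leq_trans (count (mem [:: a; e0.2]) (unzip2 l))).
    rewrite -size_filter (@perm_size _ _ [:: a; e0.2]) //.
    apply: uniq_perm; rewrite ?filter_uniq //= ?inE ?ae //.
    move=> y; rewrite mem_filter !inE.
    by apply: andb_idr => /orP[]/eqP->.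
  apply: sub_count => y; rewrite !inE /= => /orP[]/eqP->.
    by rewrite Aphi ?mem_head.
  by rewrite -lE // e0_0.
have half : 2 * size (undup_fst l) <= size l.
  by have := size_undup_double cnt2; rewrite -unzip1_undup_fst !size_map.
have l_gt0 : 0 < size l by case: (l) e0l.
have lE' : {in undup_fst l, forall e, e.1 = phi e.2}.
  by move=> e /mem_undup_fst /lE.
have [lexp' llt'] := expn_halve k_gt0 rgt half lexp llt.
have rdim' : r - k <= \dim <<unzip1 (undup_fst l)>>.
  rewrite unzip1_undup_fst (@eq_span _ _ _ (unzip1 l)); last exact: mem_undup.
  by lia.
split; first by lia.
split=> //=.
- by move=> x /mapP[e /mem_undup_fst el ->]; apply: lM; apply: map_f.
- move=> m /cover[e el Ee].
  have : e.1 \in unzip1 (undup_fst l).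
    by rewrite unzip1_undup_fst mem_undup; apply: map_f.
  case/mapP=> e' e'l Ee'; exists e' => //.
  by rewrite -lE' // -Ee' lE // (pp _ _ Ee).
- by rewrite -unzip1_phi // unzip1_undup_fst undup_uniq.
- move=> S SA; rewrite leqNgt; case/negP.
  by rewrite (_ : S = set0) ?cards0 //; apply/setP => x; rewrite inE; apply/negP => /SA.
- by rewrite unzip1_undup_fst undup_uniq.
(* The key 0 survives deduplication, so the number of classes exceeds the dimension of their span,
   as [round_dim] needs. *)
- apply: round_dim lexp' llt' => //.
  apply: leq_ltn_trans rdim' _; rewrite -(size_map fst).
  apply: dim_span_lt_size; rewrite unzip1_undup_fst mem_undup -e0_0.
  exact: map_f.
- by rewrite addn0.
Qed.

Lemma greedy_init (M : {set V}) (k : nat) (s : seq V) :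
  admissible M k -> lists s M ->
  greedy_inv M k n id id [seq (v, v) | v <- s] [::].
Proof.
move=> [[[b [bM /span_basis bV]] M0 ltM] [k_gt0 lekM lepow]] [us sM].
have sz : size s = #|M| by rewrite -(card_uniqP us) (eq_card sM).
have u1 : unzip1 [seq (v, v) | v <- s] = s by rewrite /unzip1 -map_comp map_id.
have u2 : unzip2 [seq (v, v) | v <- s] = s by rewrite /unzip2 -map_comp map_id.
have le_n : n <= \dim <<s>>.
  have dimV : \dim (fullv : {vspace V}) = n by rewrite dimvf dim_matrix [LHS]mul1n.
  rewrite -[X in X <= _]dimV; apply: dimvS; rewrite -bV; apply: sub_span => x /bM; by rewrite sM.
have szn : n < size s by apply: leq_ltn_trans le_n _; apply: dim_span_lt_size; rewrite sM.
have lexp : #|M| ^ k <= 2 ^ n by exact: expn_le_of_Rpower.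
split=> //=; rewrite ?u1 ?u2 ?size_map ?sz ?addn0 //.
- by move=> _ /mapP[x _ ->].
- by move=> x; rewrite sM.
- by move=> m mM; exists (m, m) => //; apply/mapP; exists m; rewrite ?sM.
- by rewrite map_id.
- move=> S SA; rewrite leqNgt; case/negP.
  by rewrite (_ : S = set0) ?cards0 //; apply/setP => x; rewrite inE; apply/negP => /SA.
- by apply: round_dim lexp ltM; rewrite // -sz.
Qed.

End Greedy.

(** * The algorithm as a program *)

Local Notation Nil := Defs.Nil.
Local Notation Cons := Defs.Cons.
(* main, loop, step, find, same, eq, nonzero, reduce_all, reduce, init,
   pivot_coord, xor, undup_fst.  The state of the loop is
   (l . (A . (j . k))) with j = k - size A in unary. *)
Definition greedy_program : program := [::
  Call 1 (Cons (Call 9 (Hd Arg)) (Cons Nil (Cons (Tl Arg) (Tl Arg))));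
  Call 2 (Cons (Call 3 (Cons (Hd Arg) (Hd Arg))) Arg);
  If (Hd Arg)
    (If (Hd (Tl (Tl (Tl Arg))))
      (Call 1 (Cons (Call 7 (Cons (Hd (Hd Arg)) (Hd (Tl Arg))))
        (Cons (Cons (Tl (Hd Arg)) (Hd (Tl (Tl Arg))))
          (Cons (Tl (Hd (Tl (Tl (Tl Arg))))) (Tl (Tl (Tl (Tl Arg))))))))
      (Cons (Tl (Hd Arg)) (Hd (Tl (Tl Arg)))))
    (Call 1 (Cons (Call 12 (Hd (Tl Arg)))
      (Cons Nil (Cons (Tl (Tl (Tl (Tl Arg)))) (Tl (Tl (Tl (Tl Arg))))))));
  If (Hd Arg)
    (If (Call 6 (Hd (Hd (Hd Arg))))
      (If (Tl (Call 4 (Cons (Hd (Hd (Hd Arg))) (Tl Arg))))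
        (Call 3 (Cons (Tl (Hd Arg)) (Tl Arg)))
        (Hd (Hd Arg)))
      (Call 3 (Cons (Tl (Hd Arg)) (Tl Arg))))
    Nil;
  If (Tl Arg)
    (If (Call 5 (Cons (Hd Arg) (Hd (Hd (Tl Arg)))))
      (Cons (Hd (Tl Arg)) (Call 4 (Cons (Hd Arg) (Tl (Tl Arg)))))
      (Call 4 (Cons (Hd Arg) (Tl (Tl Arg)))))
    Nil;
  If (Hd Arg)
    (If (Tl Arg)
      (If (Call 5 (Cons (Hd (Hd Arg)) (Hd (Tl Arg))))
        (Call 5 (Cons (Tl (Hd Arg)) (Tl (Tl Arg))))
        Nil)
      Nil)
    (If (Tl Arg) Nil (Cons Nil Nil));
  If Arg (If (Hd Arg) (Cons Nil Nil) (Call 6 (Tl Arg))) Nil;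
  If (Tl Arg)
    (Cons (Cons (Call 8 (Cons (Hd Arg) (Hd (Hd (Tl Arg))))) (Tl (Hd (Tl Arg))))
      (Call 7 (Cons (Hd Arg) (Tl (Tl Arg)))))
    Nil;
  If (Call 10 Arg) (Call 11 Arg) (Tl Arg);
  If Arg (Cons (Cons (Hd Arg) (Hd Arg)) (Call 9 (Tl Arg))) Nil;
  If (Hd Arg)
    (If (Hd (Hd Arg)) (Hd (Tl Arg))
      (Call 10 (Cons (Tl (Hd Arg)) (Tl (Tl Arg)))))
    Nil;
  If (Hd Arg)
    (Cons (If (Hd (Hd Arg)) (If (Hd (Tl Arg)) Nil (Cons Nil Nil)) (Hd (Tl Arg)))
      (Call 11 (Cons (Tl (Hd Arg)) (Tl (Tl Arg)))))
    Nil;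
  If Arg
    (If (Call 4 (Cons (Hd (Hd Arg)) (Tl Arg)))
      (Call 12 (Tl Arg))
      (Cons (Hd Arg) (Call 12 (Tl Arg))))
    Nil].

(** * Time-bounded evaluation and its automation *)

Definition computes (f : nat) (x d : tree) (b : nat) : Prop :=
  exists2 t, t <= b & eval greedy_program x (nth Nil greedy_program f) d t.

(** Result and time are first synthesised by evaluation, then compared with the stated ones. *)
Lemma computes_intro f x d d' t b :
  eval greedy_program x (nth Nil greedy_program f) d' t -> d' = d -> t <= b ->
  computes f x d b.
Proof. by move=> ev <- le_tb; exists t. Qed.

Lemma eval_hd P x e d d' t :
  eval P x e d t -> hd d = d' -> eval P x (Hd e) d' t.+1.
Proof. by move=> ev <-; apply: EHd. Qed.

Lemma eval_tl P x e d d' t :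
  eval P x e d t -> tl d = d' -> eval P x (Tl e) d' t.+1.
Proof. by move=> ev <-; apply: ETl. Qed.

Lemma eval_if_node P x e e1 e2 c a b d t t' :
  eval P x e c t -> c = Node a b -> eval P x e1 d t' ->
  eval P x (If e e1 e2) d (t + t').+1.
Proof. by move=> ev Ec; rewrite Ec in ev; apply: EIfNode ev. Qed.

Lemma eval_if_leaf P x e e1 e2 c d t t' :
  eval P x e c t -> c = Leaf -> eval P x e2 d t' ->
  eval P x (If e e1 e2) d (t + t').+1.
Proof. by move=> ev Ec; rewrite Ec in ev; apply: EIfLeaf. Qed.

Lemma eval_call P x f e y d t t' :
  eval P x e y t -> f < size P -> eval P y (nth Nil P f) d t' ->
  eval P x (Call f e) d (t + t').+1.
Proof. by move=> ev lt_f; apply: ECall. Qed.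

(** The conditional is decided by the computed shape of its test; a call is closed by an evaluation
    of the callee found in the context. *)
Ltac evaluate :=
  lazymatch goal with
  | |- eval _ _ Arg _ _ => exact: EArg
  | |- eval _ _ Nil _ _ => exact: ENil
  | |- eval _ _ (Cons _ _) _ _ => eapply ECons; [evaluate | evaluate]
  | |- eval _ _ (Hd _) _ _ =>
      eapply eval_hd; [evaluate | cbn [hd tl]; reflexivity]
  | |- eval _ _ (Tl _) _ _ =>
      eapply eval_tl; [evaluate | cbn [hd tl]; reflexivity]
  | |- eval _ _ (If _ _ _) _ _ =>
      first [ eapply eval_if_node; [evaluate | reflexivity | ]
            | eapply eval_if_leaf; [evaluate | reflexivity | ] ]; evaluate
  | |- eval _ _ (Call _ _) _ _ =>
      eapply eval_call; [evaluate | reflexivity | eassumption]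
  end.

Ltac run_body :=
  eapply computes_intro;
  [ match goal with |- eval ?P ?x ?e ?d ?t =>
      let e' := eval lazy in e in change (eval P x e' d t) end; evaluate
  | | ].

Definition enc_bool (b : bool) : tree := if b then Node Leaf Leaf else Leaf.

Fixpoint tree_eqb (a b : tree) : bool :=
  match a, b with
  | Leaf, Leaf => true
  | Node a1 a2, Node b1 b2 => tree_eqb a1 b1 && tree_eqb a2 b2
  | _, _ => false
  end.

Lemma tree_eqP (a b : tree) : reflect (a = b) (tree_eqb a b).
Proof.
apply: (iffP idP) => [|<-]; last by elim: a => //= a1 -> a2 ->.
elim: a b => [|a1 IH1 a2 IH2] [|b1 b2] //= /andP[/IH1-> /IH2->] //.
Qed.

Fixpoint tree_size (a : tree) : nat :=
  if a is Node a1 a2 then (tree_size a1 + tree_size a2).+1 else 1.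

(** The recursion never goes below the leaves of [a], so the size of [b] does not enter the
    bound. *)
Lemma computes_eq (a b : tree) :
  computes 5 (Node a b) (enc_bool (tree_eqb a b)) (30 * tree_size a).
Proof.
elim: a b => [|a1 IH1 a2 IH2] [|b1 b2].
- by run_body.
- by run_body.
- by run_body; rewrite //=; lia.
have [t1 le1 ev1] := IH1 b1; have [t2 le2 ev2] := IH2 b2.
rewrite /=; case: (tree_eqb a1 b1) ev1 => ev1; run_body => //=; lia.
Qed.

Lemma computes_nonzero (s : seq 'F_2) :
  computes 6 (enc_seq enc_bit s) (enc_bool (has (fun b => b != 0%R) s))
    (10 * (size s).+1).
Proof.
elim: s => [|b s [t le ev]] /=; first by run_body.
rewrite /enc_bit; case: eqP => _ /=; run_body => //=; lia.
Qed.

Lemma computes_pivot_coord (a v : seq 'F_2) :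
  size a = size v ->
  computes 10 (Node (enc_seq enc_bit a) (enc_seq enc_bit v))
    (enc_bit (nth 0%R v (find (fun b => b != 0%R) a))) (20 * (size a).+1).
Proof.
elim: a v => [|b a IH] [|c v] //=; first by move=> _; run_body.
case=> /IH[t le ev]; rewrite {1}/enc_bit; case: eqP => _ /=; run_body => //=; lia.
Qed.

Lemma computes_xor (a v : seq 'F_2) :
  size a = size v ->
  computes 11 (Node (enc_seq enc_bit a) (enc_seq enc_bit v))
    (enc_seq enc_bit [seq (x.1 + x.2)%R | x <- zip a v]) (30 * (size a).+1).
Proof.
elim: a v => [|b a IH] [|c v] //=; first by move=> _; run_body.
case=> /IH[t le ev].
case: (eqVneq b 0%R) => [->|/F2_neq0 ->]; case: (eqVneq c 0%R) => [->|/F2_neq0 ->];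
  rewrite /= ?add0r ?addr0; run_body => //=; lia.
Qed.

(** * Subroutines on encoded vectors and lists of pairs *)

Section Vectors.

Variable n : nat.
Notation V := 'rV['F_2]_n.

Definition enc_pair (e : V * V) : tree := Node (enc_vec e.1) (enc_vec e.2).

Lemma enc_vecE (v : V) : enc_vec v = enc_seq enc_bit (bits v).
Proof. by []. Qed.

Lemma enc_bits_inj : injective (enc_seq enc_bit).
Proof.
elim=> [|a s IH] [|b s'] //= [] Eb /IH ->; congr (_ :: _); move: Eb.
rewrite /enc_bit.
case: (eqVneq a 0%R) => [->|/F2_neq0 ->]; case: (eqVneq b 0%R) => [->|/F2_neq0 ->] //.
Qed.

Lemma enc_vec_inj : injective (@enc_vec n).
Proof.
move=> u v /enc_bits_inj E; apply/rowP => i.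
have := congr1 (fun s => nth 0%R s i) E; rewrite -/(bits u) -/(bits v) !nth_bits.
by rewrite (ord1 ord0).
Qed.

Lemma tree_eqb_vec (u v : V) : tree_eqb (enc_vec u) (enc_vec v) = (u == v).
Proof. by apply/tree_eqP/eqP => [/enc_vec_inj|->]. Qed.

(** A bit takes at most three tree nodes, and its list cell one more. *)
Lemma tree_size_vec (v : V) : tree_size (enc_vec v) <= 4 * n.+1.
Proof.
have le_s s : tree_size (enc_seq enc_bit s) <= 4 * (size s).+1; last first.
  by have := le_s (bits v); rewrite size_bits.
elim: s => //= b s IH.
by rewrite {1}/enc_bit; case: ifP => _ /=; lia.
Qed.

Lemma has_bits (v : V) : has (fun b => b != 0%R) (bits v) = (v != 0%R).
Proof.
apply/idP/idP => [|v0].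
  rewrite has_map => /hasP[i _ /=]; apply: contra => /eqP->; by rewrite mxE.
by have := pivot_coord_id v0; apply: contraNT; rewrite /pivot_coord /pivot
  => /hasNfind ->; rewrite nth_default.
Qed.

Lemma bitsD (u v : V) :
  bits (u + v)%R = [seq (x.1 + x.2)%R | x <- zip (bits u) (bits v)].
Proof.
rewrite /bits; elim: (enum _) => //= i s ->; by rewrite mxE.
Qed.

Lemma computes_reduce (a v : V) :
  computes 8 (Node (enc_vec a) (enc_vec v)) (enc_vec (reduce a v)) (60 * n.+1).
Proof.
have sz : size (bits a) = size (bits v) by rewrite !size_bits.
have [t1] := computes_pivot_coord sz; have [t2] := computes_xor sz.
rewrite !size_bits -!enc_vecE -bitsD -enc_vecE -/(pivot a) -/(pivot_coord a v).
rewrite /reduce /enc_bit => le2 ev2 le1; case: eqP => _ ev1; run_body => //=; lia.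
Qed.

Lemma computes_same (p : V) (l : seq (V * V)) :
  computes 4 (Node (enc_vec p) (enc_seq enc_pair l))
    (enc_seq enc_pair [seq e <- l | p == e.1]) (200 * n.+1 * (size l).+1).
Proof.
(* The summand [120 * n.+1] is the equality test, at 30 per node of a tree of size at most
   [4 * n.+1]; 40 covers the rest of the body. *)
set w := 200 * n.+1; have w_ge : 120 * n.+1 + 40 <= w by rewrite /w; lia.
elim: l => [|e l [t le ev]] /=; first by run_body => //=; lia.
have [t1] := computes_eq (enc_vec p) (enc_vec e.1).
rewrite tree_eqb_vec => le1 ev1; have := tree_size_vec p => le2.
rewrite mulnS.
case: eqP ev1 => _ ev1; rewrite /=; run_body => //=; lia.
Qed.

Lemma computes_reduce_all (p : V) (l : seq (V * V)) :
  computes 7 (Node (enc_vec p) (enc_seq enc_pair l))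
    (enc_seq enc_pair [seq (reduce p e.1, e.2) | e <- l])
    (200 * n.+1 * (size l).+1).
Proof.
set w := 200 * n.+1; have w_ge : 120 * n.+1 + 40 <= w by rewrite /w; lia.
elim: l => [|e l [t le ev]] /=; first by run_body => //=; lia.
have [t1 le1 ev1] := computes_reduce p e.1.
by rewrite mulnS; run_body => //=; lia.
Qed.

Lemma computes_init (s : seq V) :
  computes 9 (enc_vecs s) (enc_seq enc_pair [seq (v, v) | v <- s])
    (20 * (size s).+1).
Proof.
elim: s => [|v s [t le ev]] /=; first by run_body.
by run_body => //=; lia.
Qed.

Lemma size_same (p : V) (l : seq (V * V)) :
  size [seq e <- l | p == e.1] = count_mem p (unzip1 l).
Proof.
by rewrite size_filter count_map; apply: eq_count => e /=; rewrite eq_sym.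
Qed.

(** The fixed bound [N] gives every entry the same cost while the induction shortens [l]. *)
Lemma computes_undup_fst (N : nat) (l : seq (V * V)) :
  size l <= N ->
  computes 12 (enc_seq enc_pair l) (enc_seq enc_pair (undup_fst l))
    (400 * n.+1 * N.+1 * (size l).+1).
Proof.
have : 200 * n.+1 * N.+1 + 40 <= 400 * n.+1 * N.+1 by nia.
move: (400 * _ * _) => w w_ge.
elim: l => [|e l IH] /= le_lN; first by run_body => //=; lia.
have [t le ev] := IH (ltnW le_lN).
have [t1 le1 ev1] := computes_same e.1 l.
have le1' : t1 <= 200 * n.+1 * N.+1.
  by apply: leq_trans le1 _; rewrite leq_mul2l; apply/orP; right; lia.
rewrite mulnS -has_pred1 has_count -size_same.
by case: (filter _ _) ev1 => [|e' l'] ev1 /=; run_body => //=; lia.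
Qed.

(** Occurrences are counted in the whole list [w] while the scan consumes [l]. *)
Lemma computes_find (w l : seq (V * V)) :
  computes 3 (Node (enc_seq enc_pair l) (enc_seq enc_pair w))
    (if ohead (filter (candidate w) l) is Some e then enc_pair e else Leaf)
    (400 * n.+1 * (size w).+1 * (size l).+1).
Proof.
have : 200 * n.+1 * (size w).+1 + 10 * n.+1 + 60 <= 400 * n.+1 * (size w).+1 by nia.
move: (400 * _ * _) => c c_ge.
elim: l => [|e l [t le ev]] /=; first by run_body => //=; lia.
have [t1] := computes_nonzero (bits e.1); rewrite has_bits size_bits => le1 ev1.
have [t2 le2 ev2] := computes_same e.1 w.
rewrite mulnS /candidate -size_same.
case: (e.1 != 0%R) ev1 => /= ev1; last by run_body => //=; lia.
(* The program tests whether the list of matching pairs has an empty tail, that is, at most one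
   entry. *)
by case: (filter _ w) ev2 => [|x [|y s]] /= ev2; run_body => //=; lia.
Qed.

End Vectors.

(** * The main loop and the total running time *)

Section Loop.

Variable n : nat.
Notation V := 'rV['F_2]_n.

Definition enc_state (l : seq (V * V)) (A : seq V) (j k : nat) : tree :=
  Node (enc_seq (@enc_pair n) l)
    (Node (enc_vecs A) (Node (enc_nat j) (enc_nat k))).

Lemma computes_step_done (e : V * V) (l : seq (V * V)) (A : seq V) (k : nat) :
  computes 2 (Node (enc_pair e) (enc_state l A 0 k)) (enc_vecs (e.2 :: A)) 40.
Proof. by run_body. Qed.

Lemma computes_loop_via (l : seq (V * V)) (A : seq V) (j k : nat) (d : tree)
    (N b : nat) :
  size l <= N ->
  computes 2 (Node (if ohead (filter (candidate l) l) is Some e then enc_pair e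
                    else Leaf) (enc_state l A j k)) d b ->
  computes 1 (enc_state l A j k) d (400 * n.+1 * N.+1 * N.+1 + b + 20).
Proof.
move=> le_lN [t1 le1 ev1]; have [t2 le2 ev2] := computes_find l l.
have le2' : t2 <= 400 * n.+1 * N.+1 * N.+1.
  by apply: leq_trans le2 _; rewrite !leq_mul.
by run_body => //=; lia.
Qed.

(** The measure [size l * k.+2 + j] drops at each iteration: a pick lowers [j] by one, while a
    restart shortens [l] and resets [j] to [k]. Each iteration is charged one search, at most one
    pass of [undup_fst] or reduction, and constant overhead. *)
Lemma computes_loop (M : {set V}) (k N m : nat) :
  0 < k -> 0%R \in M ->
  forall (r : nat) (psi phi : V -> V) (l : seq (V * V)) (A : seq V) (j : nat),
  greedy_inv M k r psi phi l A -> size A + j = k -> size l <= N ->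
  size l * k.+2 + j < m ->
  exists q : seq V,
    [/\ computes 1 (enc_state l A j k) (enc_vecs q)
          (1000 * n.+1 * N.+1 * N.+1 * m),
        uniq q & solution M k [set x in q]].
Proof.
move=> k_gt0 M0; have : 800 * n.+1 * N.+1 * N.+1 + 120 <= 1000 * n.+1 * N.+1 * N.+1.
  by nia.
move: (1000 * _ * _ * _) => c c_ge.
elim: m => // m IH r psi phi l A j inv szA le_lN lt_m.
have Efind d b := @computes_loop_via l A j k d N b le_lN.
case Ef : (filter (candidate l) l) Efind => [|e s] /= Efind.
  have stuck : ~~ has (candidate l) l by rewrite has_filter Ef.
  have [lt_l inv'] := greedy_stuck k_gt0 M0 inv stuck.
  have [||| q [[t le ev] uq sol]] := IH _ _ _ _ _ k inv' => //.
  - exact: leq_trans (ltnW lt_l) le_lN.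
  - rewrite ltnS in lt_m; apply: leq_trans lt_m; apply: leq_trans (leq_addr _ _).
    by apply: leq_trans (leq_mul lt_l (leqnn k.+2)); rewrite mulSn [_ + k]addnC -addSn leq_add2r.
  exists q; split=> //.
  have [t1 le1 ev1] := computes_undup_fst le_lN.
  have le1' : t1 <= 400 * n.+1 * N.+1 * N.+1.
    by apply: leq_trans le1 _; rewrite leq_mul.
  have [t2 le2 ev2] : computes 2 (Node Leaf (enc_state l A j k)) (enc_vecs q) (t + t1 + 60).
    rewrite /enc_state; rewrite /enc_state in ev; run_body => //=; lia.
  have [|t3 le3 ev3] := Efind (enc_vecs q) (t + t1 + 60); first by exists t2.
  by exists t3 => //; rewrite mulnS; lia.
have : e \in filter (candidate l) l by rewrite Ef mem_head.
rewrite mem_filter => /andP[ce el].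
have [sub uq avoid next] := greedy_pick M0 inv el ce.
(* When [j = 0], [A] has [k] vectors and this pick is the last one. *)
case: j szA lt_m Efind => [|j] szA lt_m Efind.
  exists (e.2 :: A); split=> //.
    have [|t le ev] := Efind (enc_vecs (e.2 :: A)) 40.
      exact: computes_step_done.
    by exists t => //; rewrite mulnS; lia.
  split.
  - apply/subsetP => x; rewrite inE => /sub; exact: (l_sub inv).
  - by rewrite cardsE (card_uniqP uq) /= -szA addn0 addn1.
  (* If the sum lay in [M], it could itself serve as the forbidden [m]. *)
  - move=> S /subsetP SA cS; apply/negP => SM.
    have SA' : {subset S <= e.2 :: A} by move=> x /SA; rewrite inE.
    by have := avoid S SA' cS _ SM; rewrite eqxx.
have [|||| q [[t le ev] uq' sol]] := IH _ _ _ _ _ j (next _) => //.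
- by rewrite -szA; lia.
- by rewrite /= -szA; lia.
- by rewrite size_map.
- by rewrite size_map; lia.
exists q; split=> //.
have [t1 le1 ev1] := computes_reduce_all e.1 l.
have le1' : t1 <= 400 * n.+1 * N.+1 * N.+1.
  by apply: leq_trans le1 _; rewrite leq_mul //; nia.
have [t2 le2 ev2] : computes 2 (Node (enc_pair e) (enc_state l A j.+1 k))
    (enc_vecs q) (t + t1 + 100).
  rewrite /enc_state; rewrite /enc_state in ev; run_body => //=; lia.
have [|t3 le3 ev3] := Efind (enc_vecs q) (t + t1 + 100); first by exists t2.
by exists t3 => //; rewrite mulnS; lia.
Qed.

Lemma greedy_program_correct (M : {set V}) (k : nat) (s : seq V) :
  admissible M k -> lists s M ->
  exists q : seq V,
    [/\ uniq q, solution M k [set x in q]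
      & exists2 t, t <= #|M| ^ 30
        & run greedy_program (Node (enc_vecs s) (enc_nat k)) (enc_vecs q) t].
Proof.
move=> adm ls; have inv := greedy_init adm ls.
case: (adm) => [[_ M0 _] [k_gt0 lekM _]].
have sz : size s = #|M| by rewrite -(card_uniqP ls.1) (eq_card ls.2).
have ltnN : n < #|M|.
  (* The vectors of [M] span the space and include 0, so factors of [n.+1] in the time are at most
     [#|M|]. *)
  have := r_dim inv; rewrite addn0 => /leq_ltn_trans; apply.
  rewrite -sz (_ : unzip1 _ = s); last by rewrite /unzip1 -map_comp map_id.
  by apply: dim_span_lt_size; rewrite ls.2.
have [q [[t1 le1 ev1] uq sol]] :=
  computes_loop k_gt0 M0 inv (add0n k) (leqnn _) (ltnSn _).
exists q; split=> //.
have [t2 le2 ev2] := computes_init s.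
have [t3 le3 ev3] : computes 0 (Node (enc_vecs s) (enc_nat k)) (enc_vecs q) (t1 + t2 + 30).
  by rewrite /enc_state in ev1; run_body => //=; lia.
(* The two extra units are the entry call and its [Arg]. *)
exists t3.+2; last first.
  by apply: (@ECall _ _ 0 Arg _ _ 1 _ _ (EArg _ _) ev3).
move: le1 le2; rewrite size_map sz; move: #|M| lekM ltnN => N lekM ltnN le1 le2.
have N2 : 2 <= N by lia.
have le_t : t3.+2 <= 2 ^ 15 * N ^ 5.
  have leX : t1 <= 2 ^ 14 * N ^ 5.
    (* The factors dominate, in order, 1000, [n.+1], [N.+1] twice, and the initial measure plus one,
       using [k + 1 <= N]. *)
    have -> : 2 ^ 14 * N ^ 5 = 2 ^ 10 * N * (2 * N) * (2 * N) * (4 * (N * N)).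
      by rewrite (expnD 2 10 4); move: (2 ^ 10) => Y; rewrite !expnS !expn0; lia.
    have le1000 : 1000 <= 2 ^ 10 by [].
    apply: leq_trans le1 _; apply: leq_mul; last by nia.
    by apply: leq_mul; [apply: leq_mul; [apply: leq_mul | lia] | lia].
  have leN5 : N <= N ^ 5 by rewrite -{1}(expn1 N) leq_exp2l.
  have leY : 2 ^ 7 * N ^ 5 <= 2 ^ 14 * N ^ 5 by rewrite leq_mul2r leq_exp2l ?orbT.
  have E7 : 2 ^ 7 = 128 by [].
  rewrite (expnS 2 14) -mulnA; move: leX leY; rewrite E7; move: (2 ^ 14 * _) => X.
  by lia.
(* Since [N >= 2], the constant [2 ^ 15] is absorbed into [N ^ 15]. *)
apply: leq_trans le_t _; rewrite -[30]/(15 + 15) expnD leq_mul //.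
  by rewrite leq_exp2r.
by rewrite leq_exp2l.
Qed.

End Loop.

Theorem theorem1 :
  (forall (n : nat) (M : {set 'rV['F_2]_n}) (k : nat),
      admissible M k -> exists K : {set 'rV['F_2]_n}, solution M k K)
  /\
  (exists (P : program) (c : nat),
     forall (n : nat) (M : {set 'rV['F_2]_n}) (k : nat) (s : seq 'rV['F_2]_n),
       admissible M k -> lists s M ->
       exists (K : {set 'rV['F_2]_n}) (r : seq 'rV['F_2]_n) (time : nat),
         [/\ solution M k K, lists r K,
             run P (Node (enc_vecs s) (enc_nat k)) (enc_vecs r) time
           & time <= #|M| ^ c]).
Proof.
split=> [n M k adm|].
  (* Existence is read off the run of the program on an enumeration of [M]. *)
  have [|q [_ sol _]] := greedy_program_correct (s := enum M) adm.
    by split; [exact: enum_uniq | exact: mem_enum].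
  by exists [set x in q].
exists greedy_program, 30 => n M k s adm ls.
have [q [uq sol [t le_t ev]]] := greedy_program_correct adm ls.
exists [set x in q], q, t; split=> //.
by split=> // x; rewrite inE.
Qed.
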